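(* Let $G$ be a graph with $n$ vertices and $m$ edges and without isolated edges (i.e. $\varepsilon_0(G)=0$). Then $$SO(G)\ge \tfrac13\left(2\sqrt2-\sqrt5\right)\left(3M_1(G)-4m+2\sqrt5\sqrt2\,m\right)$$ and $$SO_{red}(G)\ge\left(\sqrt2-1\right)\left(M_1(G)-2m+\sqrt2\,m\right).$$ The equalities hold if and only if $G\cong P_n$ or $G\cong C_n$.
   Context: All graphs are finite, undirected and simple. $\deg_G(v)$ denotes the degree of the vertex $v$ in $G$. The degree of an edge $uv$ is its degree in the line graph of $G$, i.e. $\deg_G(u)+\deg_G(v)-2$, and $\varepsilon_i(G)$ is the number of edges of degree $i$ in $G$; so $\varepsilon_0(G)=0$ means that no edge has both endpoints of degree $1$. The first Zagreb index is $M_1(G)=\sum_{v\in V(G)}\deg_G(v)^2$. The Sombor index is $SO(G)=\sum_{uv\in E(G)}\sqrt{\deg_G(u)^2+\deg_G(v)^2}$ and the reduced Sombor index is $SO_{red}(G)=\sum_{uv\in E(G)}\sqrt{(\deg_G(u)-1)^2+(\deg_G(v)-1)^2}$. $P_n$ and $C_n$ are the path and the cycle on $n$ vertices.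
   Formalization: The equality characterization (G ≅ P_n or C_n) is stated for connected G only; without connectedness it is false, e.g. the disjoint union of two triangles attains both equalities. The inequalities are for all graphs without isolated edges. *)

(* Defs.v *)
From HB Require Import structures.
From mathcomp Require Import all_boot all_order all_algebra.

Set Implicit Arguments.
Unset Strict Implicit.
Unset Printing Implicit Defensive.

Import Order.TTheory GRing.Theory Num.Theory.
Local Open Scope ring_scope.

(* A finite simple graph is a symmetric irreflexive relation [e] on a finite
   type; the statement carries these two hypotheses. *)

Definition deg (T : finType) (e : rel T) (v : T) : nat := #|[set w | e v w]|.

(* An edge is the two-element set of its endpoints, so that a sum over
   [x in A] for an edge [A] is a sum over its two endpoints. *)
Definition edges (T : finType) (e : rel T) : {set {set T}} :=
  [set A | [exists u, exists v, e u v && (A == [set u; v])]].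

(* The truncated subtraction is harmless on edges: both endpoints have
   degree at least 1. *)
Definition edge_deg (T : finType) (e : rel T) (A : {set T}) : nat :=
  (\sum_(x in A) deg e x - 2)%N.

Definition edge_deg_count (T : finType) (e : rel T) (i : nat) : nat :=
  #|[set A in edges e | edge_deg e A == i]|.

Definition zagreb1 (T : finType) (e : rel T) : nat :=
  (\sum_(v : T) deg e v ^ 2)%N.

Definition sombor (R : rcfType) (T : finType) (e : rel T) : R :=
  \sum_(A in edges e) Num.sqrt (\sum_(x in A) (deg e x)%:R ^+ 2).

Definition sombor_red (R : rcfType) (T : finType) (e : rel T) : R :=
  \sum_(A in edges e) Num.sqrt (\sum_(x in A) ((deg e x)%:R - 1) ^+ 2).

Definition graph_connected (T : finType) (e : rel T) : Prop :=
  forall x y : T, connect e x y.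

Definition graph_iso (T U : finType) (e : rel T) (f : rel U) : Prop :=
  exists2 h : T -> U, bijective h & forall x y, f (h x) (h y) = e x y.

Definition path_graph (n : nat) : rel 'I_n :=
  fun i j => (i.+1 == j :> nat) || (j.+1 == i :> nat).

(* Only a simple graph (a cycle) for [3 <= n]; see [is_cycle]. *)
Definition cycle_graph (n : nat) : rel 'I_n :=
  fun i j => (ordS i == j) || (ordS j == i).

Definition is_path (T : finType) (e : rel T) (n : nat) : Prop :=
  graph_iso e (@path_graph n).

Definition is_cycle (T : finType) (e : rel T) (n : nat) : Prop :=
  (3 <= n)%N /\ graph_iso e (@cycle_graph n).

(* Main.v *)
(** Since [M_1] is the sum of [deg u + deg v] over the edges [uv], both bounds
    are sums over the edges of an affine function of [deg u + deg v], namely the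
    one that agrees with the edge weight at the degrees (1,2) and (2,2). It is
    strictly below the weight at all other degrees except (1,1), so equality
    means that all degrees are at most 2; for a connected graph this means a
    path or a cycle. *)

Require Import Defs.
From HB Require Import structures.
From mathcomp Require Import all_boot all_order all_algebra.
From mathcomp Require Import zify ring lra.

Set Implicit Arguments.
Unset Strict Implicit.
Unset Printing Implicit Defensive.

Import Order.TTheory GRing.Theory Num.Theory.
Local Open Scope ring_scope.

(** * Edges as two-element sets, and double counting *)

Lemma edgesP (T : finType) (e : rel T) (A : {set T}) (e_irr : irreflexive e) :
  A \in edges e -> exists u v, [/\ e u v, u != v & A = [set u; v]].
Proof.
rewrite inE => /existsP[u /existsP[v /andP[euv /eqP ->]]].
exists u, v; split=> //; apply: contraTneq euv => ->.
by rewrite e_irr.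
Qed.

Lemma mem_edges (T : finType) (e : rel T) (u v : T) :
  e u v -> [set u; v] \in edges e.
Proof.
by move=> euv; rewrite inE; apply/existsP; exists u; apply/existsP; exists v; rewrite euv /=.
Qed.

Lemma deg_gt0 (T : finType) (e : rel T) (u v : T) : e u v -> (0 < deg e u)%N.
Proof. by move=> euv; apply/card_gt0P; exists v; rewrite inE. Qed.

Lemma sum_set2 (V : nmodType) (T : finType) (F : T -> V) (u v : T) :
  u != v -> \sum_(x in [set u; v]) F x = F u + F v.
Proof. by move=> uv; rewrite big_setU1 ?inE //= big_set1. Qed.

(** The map [w |-> [set v; w]] is a bijection from the neighbours of [v] onto its incident edges;
    irreflexivity gives injectivity. *)
Lemma card_incident_edges (T : finType) (e : rel T) (v : T)
    (e_sym : symmetric e) (e_irr : irreflexive e) :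
  #|[set A in edges e | v \in A]| = deg e v.
Proof.
rewrite /deg -(@card_in_imset _ _ (fun w => [set v; w])); last first.
  move=> a b; rewrite !inE => eva evb /setP/(_ a).
  rewrite !inE eqxx orbT => /esym/orP[/eqP av|/eqP //].
  by rewrite av e_irr in eva.
apply: eq_card => A; rewrite inE; apply/andP/imsetP.
  case=> /(edgesP e_irr)[a [b [eab ab ->]]]; rewrite !inE => /orP[] /eqP ->.
    by exists b; rewrite ?inE.
  by exists a; rewrite ?inE 1?e_sym // setUC.
by case=> w; rewrite inE => evw ->; rewrite mem_edges // !inE eqxx.
Qed.

(** Exchanging the sums, each vertex contributes its degree once per incident edge, hence the square
    of its degree. *)
Lemma zagreb1_edges (T : finType) (e : rel T)
    (e_sym : symmetric e) (e_irr : irreflexive e) :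
  zagreb1 e = (\sum_(A in edges e) \sum_(x in A) deg e x)%N.
Proof.
rewrite (exchange_big_dep predT) //=; apply: eq_bigr => v _.
by rewrite sum_nat_cond_const (card_incident_edges v e_sym e_irr) mulnn.
Qed.

(** * The inequality for one edge, and its sum over all edges *)

(* For [a + b >= 4] the line lies below the root-mean-square bound
   [(a + b - 2 k) / sqrt 2], which is tight only on the diagonal. *)
Lemma chord_leif_sqrt (R : rcfType) (k t c : R) (a b : nat) :
  k <= 2 -> 2 * t < Num.sqrt 2 -> 4 * t + c = (2 - k) * Num.sqrt 2 ->
  3 * t + c = Num.sqrt ((1 - k) ^+ 2 + (2 - k) ^+ 2) ->
  (0 < a)%N -> (0 < b)%N -> (2 < a + b)%N ->
  t * (a + b)%:R + c <= Num.sqrt ((a%:R - k) ^+ 2 + (b%:R - k) ^+ 2)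
    ?= iff ((a <= 2) && (b <= 2))%N.
Proof.
move=> k2 tlt h4 h3 a0 b0 ab; apply/leifP.
have [s3|s4] := leqP (a + b) 3.
  have [[-> ->]|[-> ->]] : (a = 1 /\ b = 2 \/ a = 2 /\ b = 1)%N by lia.
    by rewrite [t * _]mulrC; apply/eqP.
  by rewrite [t * _]mulrC [X in Num.sqrt X]addrC; apply/eqP.
have r2 := sqr_sqrtr (ler0n R 2); have r0 : 0 < Num.sqrt 2 :> R by rewrite sqrtr_gt0.
set r := Num.sqrt 2 in tlt h4 r2 r0 *.
have S4 : 4 <= (a + b)%:R :> R by rewrite ler_nat.
set D2 := (a%:R - k) ^+ 2 + _.
have D0 : 0 <= D2 by rewrite addr_ge0 ?sqr_ge0.
have D2E := sqr_sqrtr D0; have := sqrtr_ge0 D2; set D := Num.sqrt D2 in D2E *.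
move=> Dge0; case: ifPn => [/andP[a2 b2]|nab].
  have [Ea Eb] : (a = 2 /\ b = 2)%N by lia.
  rewrite Ea Eb mulrC h4 -(@eqrXn2 _ 2) ?mulr_ge0 ?(ltW r0) ?subr_ge0 //.
  by rewrite D2E /D2 Ea Eb exprMn r2; apply/eqP; ring.
(* The identity 2(x^2 + y^2) = (x + y)^2 + (x - y)^2 with x = a - k and y = b - k; the last square
   is the gap in the root-mean-square bound. *)
have rD : (r * D) ^+ 2 = ((a + b)%:R - 2 * k) ^+ 2 + (a%:R - b%:R) ^+ 2.
  by rewrite exprMn r2 D2E /D2 natrD; ring.
have s0 : 0 <= (a + b)%:R - 2 * k by lra.
have rDge0 : 0 <= r * D := mulr_ge0 (ltW r0) Dge0.
have key : t * (a + b)%:R + c = (2 - k) * r + t * ((a + b)%:R - 4).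
  by rewrite -h4; ring.
rewrite -(ltr_pM2l r0) key.
have keyr : r * ((2 - k) * r + t * ((a + b)%:R - 4)) =
   4 - 2 * k + (r * t) * ((a + b)%:R - 4).
  by rewrite mulrDr mulrCA -expr2 r2; ring.
have rt : r * t < 1.
  by have : r * (2 * t) < r * r by [rewrite ltr_pM2l]; lra.
(* After scaling by [r], the line and a + b - 2k agree at a + b = 4, with slopes [r * t < 1] and 1.
   If a = b, then a + b > 4 and the slopes give strictness; otherwise the gap between a and b
   does. *)
rewrite keyr; have [Eab|neq] := eqVneq a b.
  have S5 : 4 < (a + b)%:R :> R by rewrite ltr_nat; lia.
  have : (a + b)%:R - 2 * k <= r * D.
    by rewrite -(@ler_pXn2r _ 2) ?nnegrE // rD lerDl sqr_ge0.
  by nra.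
have : (a + b)%:R - 2 * k < r * D.
  rewrite -(@ltr_pXn2r _ 2) ?nnegrE // rD ltrDl lt_def sqr_ge0 andbT.
  by rewrite sqrf_eq0 subr_eq0 eqr_nat.
by nra.
Qed.

(** Rules out the degrees (1,1), where the affine function exceeds the weight in both
    applications. *)
Lemma nonisolated_edge (T : finType) (e : rel T) (u v : T) :
  u != v -> edge_deg_count e 0 = 0%N -> e u v -> (2 < deg e u + deg e v)%N.
Proof.
move=> uv /eqP; rewrite cards_eq0 => /eqP/setP/(_ [set u; v]) + euv.
by rewrite in_set0 in_set mem_edges //= /edge_deg sum_set2 //; lia.
Qed.

(** Treats both indices at once: [k = 0] is the Sombor index and [k = 1] the reduced one. *)
Lemma zagreb1_leif_sombor (R : rcfType) (T : finType) (e : rel T) (k t c : R)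
    (e_sym : symmetric e) (e_irr : irreflexive e) :
  edge_deg_count e 0 = 0%N ->
  k <= 2 -> 2 * t < Num.sqrt 2 -> 4 * t + c = (2 - k) * Num.sqrt 2 ->
  3 * t + c = Num.sqrt ((1 - k) ^+ 2 + (2 - k) ^+ 2) ->
  t * (zagreb1 e)%:R + c * #|edges e|%:R
    <= \sum_(A in edges e) Num.sqrt (\sum_(x in A) ((deg e x)%:R - k) ^+ 2)
    ?= iff [forall v, (deg e v <= 2)%N].
Proof.
move=> noiso k2 tlt h4 h3.
have -> : t * (zagreb1 e)%:R + c * #|edges e|%:R =
    \sum_(A in edges e) (t * (\sum_(x in A) deg e x)%:R + c).
  rewrite big_split /= sumr_const -[c *+ _]mulr_natr; congr (_ + _).
  by rewrite zagreb1_edges // natr_sum mulr_sumr.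
(* The condition on vertices can be checked edge by edge, since a vertex on no edge has degree 0. *)
have -> : [forall v, (deg e v <= 2)%N] =
    [forall (A | A \in edges e), [forall x in A, (deg e x <= 2)%N]].
  apply/forallP/forall_inP => [h A _|h v]; first by apply/forall_inP.
  have [/eqP|/card_gt0P[w]] := posnP (deg e v); first by lia.
  rewrite inE => evw; have /forall_inP := h _ (mem_edges evw); apply.
  by rewrite !inE eqxx.
apply: leif_sum => A /(edgesP e_irr)[u [v [euv uv ->]]].
rewrite !sum_set2 //.
have -> : [forall x in [set u; v], (deg e x <= 2)%N] =
    ((deg e u <= 2) && (deg e v <= 2))%N.
  apply/forall_inP/andP => [h|[hu hv] x]; first by split; apply: h; rewrite !inE eqxx ?orbT.
  by rewrite !inE => /orP[] /eqP ->.
apply: chord_leif_sqrt => //; first exact: deg_gt0 euv.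
  by apply: deg_gt0 (_ : e v u); rewrite e_sym.
exact: nonisolated_edge.
Qed.

(** * Connected graphs of maximum degree at most 2 *)

Lemma deg_ge3 (T : finType) (e : rel T) (v a b c : T) :
  e v a -> e v b -> e v c -> uniq [:: a; b; c] -> (2 < deg e v)%N.
Proof.
move=> va vb vc /card_uniqP s3; rewrite -[3%N]s3; apply/subset_leq_card/subsetP => x.
by rewrite !inE => /or3P[] /eqP ->.
Qed.

Lemma graph_iso_deg (T U : finType) (e : rel T) (f : rel U) (h : T -> U) :
  bijective h -> (forall x y, f (h x) (h y) = e x y) ->
  forall v, deg e v = deg f (h v).
Proof.
move=> hbij eh v; rewrite /deg -(card_imset _ (bij_inj hbij)).
have [g hK gK] := hbij; apply: eq_card => y; rewrite inE.
apply/imsetP/idP => [[w]|fy]; first by rewrite inE => evw ->; rewrite eh.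
by exists (g y); rewrite ?inE ?gK // -eh gK.
Qed.

Lemma path_subrel_cycle (n : nat) : subrel (@path_graph n) (@cycle_graph n).
Proof.
move=> i j /orP[] /eqP h; apply/orP; [left|right]; apply/eqP/val_inj.
  by rewrite /= h modn_small.
by rewrite /= h modn_small.
Qed.

Lemma deg_cycle_graph (n : nat) (i : 'I_n) : (deg (@cycle_graph n) i <= 2)%N.
Proof.
apply: leq_trans (_ : #|[set ordS i; ord_pred i]| <= 2)%N; last first.
  by rewrite cards2; case: eqP.
apply/subset_leq_card/subsetP => j; rewrite !inE => /orP[] /eqP <-.
  by rewrite eqxx.
by rewrite ordSK eqxx orbT.
Qed.

Lemma deg_path_graph (n : nat) (i : 'I_n) : (deg (@path_graph n) i <= 2)%N.
Proof.
apply: leq_trans (deg_cycle_graph i); apply/subset_leq_card/subsetP => j.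
by rewrite !inE; apply: path_subrel_cycle.
Qed.

(* A longest simple path is closed under taking neighbours: at an end by
   maximality, at an inner vertex because both its neighbours are on it. *)
Lemma spanning_path (T : finType) (e : rel T) (e_sym : symmetric e) :
  graph_connected e -> (forall v, deg e v <= 2)%N ->
  exists s : seq T, [/\ sorted e s, uniq s & s =i predT].
Proof.
move=> conn deg2.
(* Tuples make the existence of a simple path with [k] vertices a boolean predicate of [k], bounded
   by [#|T|], so a maximal [k] exists. *)
pose P k := [exists t : k.-tuple T, sorted e t && uniq t].
have P0 : exists k, P k by exists 0%N; apply/existsP; exists [tuple].
have Pmax k : P k -> (k <= #|T|)%N.
  by case/existsP=> t /andP[_ /card_uniqP]; rewrite size_tuple => <-; apply: max_card.
have Pseq (s : seq T) : sorted e s -> uniq s -> P (size s).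
  by move=> s1 s2; apply/existsP; exists (in_tuple s); rewrite /= s1.
case: (ex_maxnP P0 Pmax) => k /existsP[t /andP[t_sorted t_uniq]] t_max.
exists t; split=> // x; rewrite inE.
have k_gt0 : (0 < k)%N by apply: (t_max 1%N); apply: (Pseq [:: x]).
have sz := size_tuple t; move: (tval t) sz t_sorted t_uniq => s sz s_sorted s_uniq.
have step i : (i.+1 < k)%N -> e (nth x s i) (nth x s i.+1).
  by rewrite -sz; apply: sortedP.
have closed u w : u \in s -> e u w -> w \in s.
  move=> us; rewrite -(nth_index x us); move: us; rewrite -index_mem sz.
  move: (index u s) => i ik eiw; apply: contraT => ws.
  have [i0|i_gt0] := posnP i.
    have /t_max : P (size (w :: s)).
      apply: Pseq; rewrite /= ?ws //; move: eiw; rewrite i0.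
      by case: (s) s_sorted sz k_gt0 => [|a s'] /= h; [lia|rewrite e_sym => _ _ ->].
    by rewrite /= sz ltnn.
  have [ilast|i_lt] := eqVneq i.+1 k.
    have /t_max : P (size (rcons s w)).
      apply: Pseq; rewrite ?rcons_uniq ?ws //; apply/(sortedP x) => j.
      rewrite size_rcons sz !nth_rcons sz => jk.
      have [jlt|jge] := ltnP j.+1 k; first by rewrite ltnW // step.
      have -> : (j < k)%N by lia.
      have -> : j.+1 == k by lia.
      by have -> : j = i by lia.
    by rewrite size_rcons sz ltnn.
  have := deg2 (nth x s i); rewrite leqNgt (@deg_ge3 _ _ _ (nth x s i.-1) (nth x s i.+1) w) //.
  - by rewrite e_sym; have := @step i.-1; rewrite prednK //; apply.
  - by apply: step; lia.
  rewrite /= !inE nth_uniq ?sz //; [|lia|lia].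
  rewrite negb_or andbT -andbA; apply/and3P; split; first by lia.
    by apply: contraNneq ws => <-; rewrite mem_nth ?sz //; lia.
  by apply: contraNneq ws => <-; rewrite mem_nth ?sz //; lia.
have x0s : nth x s 0 \in s by rewrite mem_nth ?sz.
have /connectP[p] := conn (nth x s 0) x.
(* A walk that starts on the path never leaves it, so by connectedness the path spans. *)
elim: p (nth x s 0) x0s => [|y p IHp] z zs /= => [_ -> //|/andP[ezy ep]].
by apply: IHp ep; apply: closed ezy.
Qed.

(** A chord at an inner vertex of the path would give that vertex a third neighbour, so the only
    possible chord joins the two ends. *)
Lemma edges_spanning_path (T : finType) (e : rel T) (x : T) (s : seq T)
    (e_sym : symmetric e) :
  (forall v, deg e v <= 2)%N -> sorted e s -> uniq s ->
  forall i j, (i < j < size s)%N ->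
  e (nth x s i) (nth x s j) =
  (j == i.+1) || [&& i == 0%N, j.+1 == size s & e (nth x s 0) (nth x s (size s).-1)].
Proof.
move=> deg2 /(sortedP x) step s_uniq i j /andP[ij js].
have [->|ji] /= := eqVneq j i.+1; first by rewrite step; lia.
apply/idP/and3P => [eij|[/eqP -> /eqP js' h]]; last by move: h; rewrite -js'.
have i1s : (i.+1 < size s)%N := leq_ltn_trans ij js.
have i_s := ltnW i1s; have i's := leq_ltn_trans (leq_pred i) i_s.
have i0 : i = 0%N.
  have [//|i_gt0] := posnP i.
  have := deg2 (nth x s i); rewrite leqNgt.
  rewrite (@deg_ge3 _ _ _ (nth x s i.-1) (nth x s i.+1) (nth x s j)) //.
  - by rewrite e_sym; have := step i.-1; rewrite prednK //; apply.
  - exact: step.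
  - by rewrite /= !inE !nth_uniq //; lia.
have jl : j.+1 = size s.
  apply/eqP; apply: contraT => jn.
  have j1s : (j.+1 < size s)%N by rewrite ltn_neqAle jn.
  have j's := leq_ltn_trans (leq_pred j) js; have := deg2 (nth x s j); rewrite leqNgt.
  rewrite (@deg_ge3 _ _ _ (nth x s j.-1) (nth x s j.+1) (nth x s i)) //.
  - by rewrite e_sym; have := step j.-1; rewrite prednK ?(leq_ltn_trans _ ij) //; apply.
  - exact: step.
  - by rewrite e_sym.
  - by rewrite /= !inE !nth_uniq //; lia.
by split; rewrite ?i0 ?jl //; move: eij; rewrite i0 -jl.
Qed.

Lemma connected_deg2_path_or_cycle (T : finType) (e : rel T)
    (e_sym : symmetric e) (e_irr : irreflexive e) :
  graph_connected e -> (forall v, deg e v <= 2)%N ->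
  is_path e #|T| \/ is_cycle e #|T|.
Proof.
move=> conn deg2; have [s [s_sorted s_uniq sT]] := spanning_path e_sym conn deg2.
have -> : #|T| = size s by rewrite -(card_uniqP s_uniq); apply/esym/eq_card.
(* The position along the spanning path serves as the isomorphism in both cases. *)
pose h x := Ordinal (etrans (index_mem x s) (sT x)).
have hbij : bijective h.
  exists (tnth (in_tuple s)) => [x|i]; first by rewrite (tnth_nth x) /= nth_index ?sT.
  by apply: val_inj; rewrite /= (tnth_nth (tnth (in_tuple s) i)) /= index_uniq.
have iso (f : rel 'I_(size s)) : symmetric f -> irreflexive f ->
    (forall (x : T) (i j : 'I_(size s)), (i < j)%N ->
      f i j = e (nth x s i) (nth x s j)) -> graph_iso e f.
  move=> f_sym f_irr fe; exists h => // x y.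
  have [xy|yx|/val_inj xy] := ltngtP (h x) (h y).
  - by rewrite (fe x) //= !nth_index ?sT.
  - by rewrite f_sym (fe x) //= !nth_index ?sT // e_sym.
  - by rewrite xy (bij_inj hbij xy) e_irr f_irr.
have path_sym : symmetric (@path_graph (size s)) by move=> i j; rewrite /path_graph orbC.
have cycle_sym : symmetric (@cycle_graph (size s)) by move=> i j; rewrite /cycle_graph orbC.
have eE x := edges_spanning_path x e_sym deg2 s_sorted s_uniq.
(* The existential also supplies the default element of [nth], as [T] may be empty. *)
have [/andP[s3 /existsP[x ends]]|short] :=
  boolP ((3 <= size s)%N && [exists x, e (nth x s 0) (nth x s (size s).-1)]).
  right; split=> //; apply: iso => // [i|y i j ij].
    rewrite /cycle_graph orbb; apply/negbTE/eqP => /(congr1 val) /=.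
    have [si|si] := eqVneq i.+1 (size s); first by rewrite si modnn; lia.
    by rewrite modn_small; have := ltn_ord i; lia.
  have js := ltn_ord j.
  rewrite eE ?ij //= (set_nth_default x) ?[in nth y _ (_.-1)](set_nth_default x) ?ends; try lia.
  rewrite andbT /cycle_graph -!val_eqE /= modn_small; last by lia.
  rewrite eq_sym; congr (_ || _).
  (* As i < j, the successor of [j] can equal [i] only by wrapping around, from the last position to
     0. *)
  have [sj|sj] := eqVneq j.+1 (size s); first by rewrite sj modnn andbT eq_sym.
  by rewrite andbF modn_small; lia.
left; apply: iso => // [i|y i j ij]; first by rewrite /path_graph orbb; lia.
have js := ltn_ord j; rewrite eE ?ij //= /path_graph.
(* With at most two vertices, the edge joining the ends is already an edge between consecutive
   positions; otherwise the ends are not adjacent. *)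
move: short; rewrite negb_and negb_exists => /orP[s2|/forallP/(_ y)/negbTE ->]; last first.
  by rewrite !andbF orbF; lia.
by case: (e _ _); rewrite ?andbF ?andbT; lia.
Qed.

Lemma path_or_cycleP (T : finType) (e : rel T)
    (e_sym : symmetric e) (e_irr : irreflexive e) :
  graph_connected e ->
  [forall v, (deg e v <= 2)%N] <-> is_path e #|T| \/ is_cycle e #|T|.
Proof.
move=> conn; split=> [/forallP|].
  exact: connected_deg2_path_or_cycle.
case=> [[h hbij eh]|[_ [h hbij eh]]]; apply/forallP => v.
  by rewrite (graph_iso_deg hbij eh) deg_path_graph.
by rewrite (graph_iso_deg hbij eh) deg_cycle_graph.
Qed.

(** * The two bounds with their equality cases *)

Theorem theorem3p10 (R : rcfType) (T : finType) (e : rel T) (n m : nat)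
    (e_sym : symmetric e) (e_irr : irreflexive e)
    (card_V : #|T| = n) (card_E : #|edges e| = m)
    (no_isolated_edge : edge_deg_count e 0 = 0%N) :
  let r2 : R := Num.sqrt 2 in
  let r5 : R := Num.sqrt 5 in
  let M1 : R := (zagreb1 e)%:R in
  let bound : R :=
    1 / 3 * (2 * r2 - r5) * (3 * M1 - 4 * m%:R + 2 * r5 * r2 * m%:R) in
  let bound_red : R := (r2 - 1) * (M1 - 2 * m%:R + r2 * m%:R) in
  [/\ bound <= sombor R e,
      bound_red <= sombor_red R e,
      graph_connected e ->
        (sombor R e = bound <-> is_path e n \/ is_cycle e n)
    & graph_connected e ->
        (sombor_red R e = bound_red <-> is_path e n \/ is_cycle e n)].
Proof.
move=> r2 r5 M1 bound bound_red.
have r2sq : r2 ^+ 2 = 2 := sqr_sqrtr (ler0n R 2).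
have r5sq : r5 ^+ 2 = 5 := sqr_sqrtr (ler0n R 5).
have r2_gt0 : 0 < r2 by rewrite sqrtr_gt0.
have r5_gt0 : 0 < r5 by rewrite sqrtr_gt0.
have equality (b S : R) :
    b <= S ?= iff [forall v, (deg e v <= 2)%N] -> graph_connected e ->
    (S = b <-> is_path e n \/ is_cycle e n).
  move=> [_ bS] conn; rewrite -card_V -(path_or_cycleP e_sym e_irr conn) -bS.
  by split=> [->|/eqP].
have leif : bound <= sombor R e ?= iff [forall v, (deg e v <= 2)%N].
  (* The slope [2 * r2 - r5] is the difference of the weights at (2,2) and (1,2); [c] is the
     intercept of that chord, the coefficient of [m] in [bound]. *)
  pose c := 1 / 3 * (2 * r2 - r5) * (2 * r5 * r2 - 4).
  have -> : bound = (2 * r2 - r5) * M1 + c * #|edges e|%:R.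
    by rewrite /bound /c card_E; field.
  have -> : sombor R e = \sum_(A in edges e)
      Num.sqrt (\sum_(x in A) ((deg e x)%:R - 0) ^+ 2).
    by apply: eq_bigr => A _; under [in RHS]eq_bigr do rewrite subr0.
  apply: zagreb1_leif_sombor => //; rewrite -/r2.
  (* The slope condition amounts to [3 * r2 < 2 * r5], that is 18 < 20 after squaring. *)
  - by nra.
  - by rewrite /c; nra.
  - have -> : (1 - 0) ^+ 2 + (2 - 0) ^+ 2 = 5 :> R by ring.
    by rewrite -/r5 /c; nra.
have leif_red : bound_red <= sombor_red R e ?= iff [forall v, (deg e v <= 2)%N].
  (* Here the weights at (1,2) and (2,2) are 1 and [r2], which gives the slope [r2 - 1]. *)
  have -> : bound_red = (r2 - 1) * M1 + (r2 - 1) * (r2 - 2) * #|edges e|%:R.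
    by rewrite /bound_red card_E; ring.
  apply: zagreb1_leif_sombor => //; rewrite -/r2.
  - by rewrite ler1n.
  - by nra.
  - by nra.
  - have -> : (1 - 1) ^+ 2 + (2 - 1) ^+ 2 = 1 :> R by ring.
    by rewrite sqrtr1; nra.
by split; [exact: leif.1|exact: leif_red.1|exact: equality|exact: equality].
Qed.
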